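(* Suppose $p$ is a prime congruent to $1$ modulo $9$ that is not Exceptional $A$. Write $p$ as $\pi\bar{\pi}$ with $\pi\in\mathcal{O}$ and $\pi\equiv 1\pmod{3}$. Then neither $\pi$ nor $\pi^{2}$ is a sum of two cubes in $\mathcal{K}$.
   Context: Let $u$ and $v$ be the two roots in $\mathbb{C}$ of $z^{2}+z+1=0$ (so $u,v$ are the primitive cube roots of unity). $\mathcal{O}$ is the set of $\mathbb{Z}$-linear combinations of $1,u,v$ (the ring of Eisenstein integers) and $\mathcal{K}$ is the set of $\mathbb{Q}$-linear combinations of $1,u,v$ (its field of fractions). A prime $p\equiv 1\pmod 3$ can be written as $p=\pi\bar\pi$ with $\pi\in\mathcal{O}$ irreducible and $\pi\equiv 1\pmod{3}$ in $\mathcal{O}$. Such a $p$ is Exceptional $A$ if it has an irreducible factor in $\mathcal{O}$ that is congruent modulo $9$ (in $\mathcal{O}$) to an integer (element of $\mathbb{Z}$). *)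

(* Defs.v *)
From mathcomp Require Import all_boot all_order all_algebra.

Set Implicit Arguments.
Unset Strict Implicit.
Unset Printing Implicit Defensive.

Import GRing.Theory.
Local Open Scope ring_scope.

Definition two_roots (C : fieldType) (u v : C) : Prop :=
  u != v /\ forall z : C, root ('X^2 + 'X + 1) z <-> z = u \/ z = v.

(* In what follows u and v are meant to satisfy [two_roots u v]; O and K are
   then the Eisenstein integers and their field of fractions, as subsets of C. *)
Definition inO (C : fieldType) (u v x : C) : Prop :=
  exists a b c : int, x = a%:~R + b%:~R * u + c%:~R * v.

Definition inK (C : fieldType) (u v x : C) : Prop :=
  exists a b c : rat, x = ratr a + ratr b * u + ratr c * v.

Definition dvdO (C : fieldType) (u v d x : C) : Prop :=
  exists2 t : C, inO u v t & x = d * t.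

Definition eqmodO (C : fieldType) (u v m x y : C) : Prop :=
  dvdO u v m (x - y).

Definition unitO (C : fieldType) (u v x : C) : Prop :=
  inO u v x /\ exists2 y : C, inO u v y & x * y = 1.

Definition irreducibleO (C : fieldType) (u v x : C) : Prop :=
  [/\ inO u v x, x != 0, ~ unitO u v x &
      forall a b : C, inO u v a -> inO u v b -> x = a * b ->
        unitO u v a \/ unitO u v b].

Definition exceptionalA (C : fieldType) (u v : C) (p : nat) : Prop :=
  [/\ prime p, (p = 1 %[mod 3])%N &
      exists r : C, [/\ irreducibleO u v r, dvdO u v r p%:R &
        exists n : int, eqmodO u v 9%:R r n%:~R]].

Definition sum_two_cubesK (C : fieldType) (u v x : C) : Prop :=
  exists a b : C, [/\ inK u v a, inK u v b & x = a ^+ 3 + b ^+ 3].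

(* Main.v *)
Require Import Defs.
From HB Require Import structures.
From mathcomp Require Import all_boot all_order all_algebra.
From mathcomp Require Import reals complex.
From mathcomp Require Import zify ring lra.
Import Order.TTheory GRing.Theory Num.Theory.

Local Open Scope ring_scope.

(** Fermat descent along lambda = 1 - omega.  Let A be pi or pi^2, and suppose
    that x^3 + y^3 = A z^3 with x, y coprime Eisenstein integers and z <> 0.
    The factors x + y, omega x + omega^2 y, omega^2 x + omega y have sum 0 and
    product A z^3, and after division by lambda when lambda divides z they are
    pairwise coprime.  As pi is prime, they are A e1 X^3, e2 Y^3, e3 Z^3 in some
    order, with units e1, e2, e3 whose product is a cube; absorbing signs, the
    ei are powers of omega that are either all equal or all distinct.  Since
    p = 1 modulo 9 and p is not Exceptional A, A is congruent to 1 modulo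
    lambda^3 but not modulo 9, whereas cubes prime to lambda are congruent to 1
    or -1 modulo 9: this excludes distinct ei.  If the ei are equal, then
    (Y, Z, -X) is a new solution; it is smaller when lambda divides z, and
    impossible modulo 9 when lambda does not divide z. *)

(** * The ring of Eisenstein integers *)

(* [Eis a b] stands for a + b omega, with omega^2 + omega + 1 = 0. *)
Record eis := Eis { cre : int; cw : int }.

Definition pair_of_eis (x : eis) := (cre x, cw x).
Definition eis_of_pair (x : int * int) := Eis x.1 x.2.
Lemma pair_of_eisK : cancel pair_of_eis eis_of_pair.
Proof. by case. Qed.
HB.instance Definition _ := Choice.copy eis (can_type pair_of_eisK).

Definition addE x y := Eis (cre x + cre y) (cw x + cw y).
Definition oppE x := Eis (- cre x) (- cw x).
Definition mulE x y :=
  Eis (cre x * cre y - cw x * cw y)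
      (cre x * cw y + cw x * cre y - cw x * cw y).

Lemma eis_eq x y : cre x = cre y -> cw x = cw y -> x = y.
Proof. by case: x y => a b [c d] /= -> ->. Qed.

Lemma addEA : associative addE.
Proof. by move=> x y z; apply: eis_eq => /=; ring. Qed.
Lemma addEC : commutative addE.
Proof. by move=> x y; apply: eis_eq => /=; ring. Qed.
Lemma add0E : left_id (Eis 0 0) addE.
Proof. by move=> x; apply: eis_eq => /=; ring. Qed.
Lemma addNE : left_inverse (Eis 0 0) oppE addE.
Proof. by move=> x; apply: eis_eq => /=; ring. Qed.
HB.instance Definition _ := GRing.isZmodule.Build eis addEA addEC add0E addNE.

Lemma mulEA : associative mulE.
Proof. by move=> x y z; apply: eis_eq => /=; ring. Qed.
Lemma mulEC : commutative mulE.
Proof. by move=> x y; apply: eis_eq => /=; ring. Qed.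
Lemma mul1E : left_id (Eis 1 0) mulE.
Proof. by move=> x; apply: eis_eq => /=; ring. Qed.
Lemma mulEDl : left_distributive mulE addE.
Proof. by move=> x y z; apply: eis_eq => /=; ring. Qed.
Lemma oneE_neq0 : Eis 1 0 != 0.
Proof. by []. Qed.
HB.instance Definition _ :=
  GRing.Zmodule_isComNzRing.Build eis mulEA mulEC mul1E mulEDl oneE_neq0.

Lemma creD (x y : eis) : cre (x + y) = cre x + cre y.
Proof. by []. Qed.
Lemma cwD (x y : eis) : cw (x + y) = cw x + cw y.
Proof. by []. Qed.
Lemma creN (x : eis) : cre (- x) = - cre x.
Proof. by []. Qed.
Lemma cwN (x : eis) : cw (- x) = - cw x.
Proof. by []. Qed.
Lemma creM (x y : eis) : cre (x * y) = cre x * cre y - cw x * cw y.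
Proof. by []. Qed.
Lemma cwM (x y : eis) : cw (x * y) = cre x * cw y + cw x * cre y - cw x * cw y.
Proof. by []. Qed.
Lemma cre1 : cre (1 : eis) = 1.
Proof. by []. Qed.
Lemma cw1 : cw (1 : eis) = 0.
Proof. by []. Qed.
Lemma cre0 : cre (0 : eis) = 0.
Proof. by []. Qed.
Lemma cw0 : cw (0 : eis) = 0.
Proof. by []. Qed.
Lemma cre_nat n : cre (n%:R : eis) = n%:R.
Proof. by elim: n => // n IH; rewrite !mulrS creD IH. Qed.
Lemma cw_nat n : cw (n%:R : eis) = 0.
Proof. by elim: n => // n IH; rewrite mulrS cwD IH. Qed.
Definition coordE :=
  (cre_nat, cw_nat, cre1, cw1, cre0, cw0, creD, cwD, creN, cwN, creM, cwM).

(** * Conjugation, norm and units *)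

Definition conjE x := Eis (cre x - cw x) (- cw x).
Definition normE x : int := cre x ^+ 2 - cre x * cw x + cw x ^+ 2.
Definition omega := Eis 0 1.
Definition lam := Eis 1 (-1).

Lemma normM (x y : eis) : normE (x * y) = normE x * normE y.
Proof. by rewrite /normE !coordE; ring. Qed.
Lemma normE_ge0 (x : eis) : 0 <= normE x.
Proof. by rewrite /normE; nia. Qed.
Lemma normE_eq0 (x : eis) : normE x = 0 -> x = 0.
Proof.
rewrite /normE => h.
have b0 : cw x = 0.
  apply/eqP; rewrite -sqrf_eq0 eq_le sqr_ge0 andbT.
  (* Four times the norm of a + b omega is (2a - b)^2 + 3b^2. *)
  by have := sqr_ge0 (2 * cre x - cw x); lia.
apply: eis_eq; rewrite coordE //; apply/eqP; rewrite -sqrf_eq0.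
by move: h; rewrite b0 mulr0 subr0 addr0 => ->.
Qed.
Lemma normE_gt0 (x : eis) : x <> 0 -> 0 < normE x.
Proof.
by move=> x0; rewrite lt0r normE_ge0 andbT; apply/eqP => /normE_eq0.
Qed.
Lemma mulE_conj (x : eis) : x * conjE x = Eis (normE x) 0.
Proof. by apply: eis_eq; rewrite !coordE /normE /=; ring. Qed.

Lemma mulE_eq0 (x y : eis) : x * y = 0 -> x = 0 \/ y = 0.
Proof.
move=> h; have : normE x * normE y == 0 by rewrite -normM h.
by rewrite mulf_eq0 => /orP [] /eqP /normE_eq0; [left|right].
Qed.
Lemma mulE_cancel (x y z : eis) : x <> 0 -> x * y = x * z -> y = z.
Proof.
move=> x0 h; have : x * (y - z) = 0 by rewrite mulrBr h subrr.
by move/mulE_eq0 => [//|/eqP]; rewrite subr_eq0 => /eqP.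
Qed.

Lemma cube_neq0 (x : eis) : x <> 0 -> x ^+ 3 <> 0.
Proof. by move=> x0; rewrite !exprS expr0 mulr1 => /mulE_eq0 [//|/mulE_eq0 []]. Qed.

Lemma norm1_unit (x : eis) : normE x = 1 -> x * conjE x = 1.
Proof. by rewrite mulE_conj => ->. Qed.
Lemma unit_norm (x y : eis) : x * y = 1 -> normE x = 1.
Proof.
move=> xy; have h : normE x * normE y = 1 by rewrite -normM xy.
move: {xy} (normE x) (normE y) (normE_ge0 x) (normE_ge0 y) h => a b a0 b0 h.
have : (b != 0) by apply/eqP => b1; move: h; rewrite b1 mulr0.
by nia.
Qed.

(** The sign [s] is written as [s ^+ 3], which equals it, so that it can later be absorbed into a
    cube. *)
Lemma norm1_cases (x : eis) : normE x = 1 ->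
  exists s k, [/\ (k < 3)%N, s ^+ 2 = 1 & x = s ^+ 3 * omega ^+ k].
Proof.
case: x => a b; rewrite /normE /= !expr2 => h.
have : (a = 1 /\ b = 0) \/ (a = -1 /\ b = 0) \/ (a = 0 /\ b = 1) \/
  (a = 0 /\ b = -1) \/ (a = 1 /\ b = 1) \/ (a = -1 /\ b = -1).
  have bound (c : int) : 3 * (c * c) <= 4 -> -1 <= c <= 1 by nia.
  have ha : -1 <= a <= 1.
    by apply: bound; have := sqr_ge0 (2 * b - a); rewrite expr2; lia.
  have hb : -1 <= b <= 1.
    by apply: bound; have := sqr_ge0 (2 * a - b); rewrite expr2; lia.
  have : a = -1 \/ a = 0 \/ a = 1 by lia.
  have : b = -1 \/ b = 0 \/ b = 1 by lia.
  by move=> [|[|]] eb [|[|]] ea; move: h; rewrite ea eb; lia.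
move=> [|[|[|[|[|]]]]] [-> ->].
- by exists 1, 0%N; split.
- by exists (-1), 0%N; split.
- by exists 1, 1%N; split.
- by exists (-1), 1%N; split.
- by exists (-1), 2%N; split.
- by exists 1, 2%N; split.
Qed.

(** * Euclidean division, greatest common divisors and coprimality *)

(** For positive n this is the floor of a/n + 1/2, an integer nearest to a/n. *)
Definition divz_round (a n : int) : int := ((2 * a + n) %/ (2 * n))%Z.
Lemma divz_roundP a n : 0 < n -> - n <= 2 * (a - divz_round a n * n) <= n.
Proof.
move=> n0; rewrite /divz_round; have := divz_eq (2 * a + n) (2 * n).
have : 0 <= ((2 * a + n) %% (2 * n))%Z < 2 * n.
  rewrite modz_ge0 ?ltz_pmod; lia.
by move: (_ %/ _)%Z (_ %% _)%Z => q r; nia.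
Qed.

(** The quotient is x conj(y) / N(y) with both coordinates rounded. The rounding errors are at most
    1/2, so the remainder has norm at most 3/4 of N(y). *)
Lemma eis_edivide (x y : eis) : y <> 0 -> exists q, normE (x - q * y) < normE y.
Proof.
move=> y0; have n0 := normE_gt0 _ y0.
set n := normE y in n0 *.
pose t := x * conjE y.
pose q := Eis (divz_round (cre t) n) (divz_round (cw t) n); exists q.
have ha := divz_roundP (cre t) n n0; have hb := divz_roundP (cw t) n n0.
have e : normE (x - q * y) * n =
    normE (Eis (cre t - divz_round (cre t) n * n) (cw t - divz_round (cw t) n * n)).
  have -> : normE (x - q * y) * n = normE (x - q * y) * normE (conjE y).
    by congr (_ * _); rewrite /n /normE /=; ring.
  rewrite -normM mulrBl -mulrA [y * _]mulE_conj -/n.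
  by congr normE; apply: eis_eq; rewrite /t ?coordE /=; ring.
move: e; rewrite {2}/normE /=; move: ha hb.
set a := cre t - _; set b := cw t - _ => ha hb e.
move: (normE _) e => m e.
have : 4 * (a ^+ 2 - a * b + b ^+ 2) <= 3 * n ^+ 2 by nia.
by rewrite -e => h; nia.
Qed.

Definition dvdE (x y : eis) := exists t, y = x * t.
Definition coprE (x y : eis) := exists s t, s * x + t * y = 1.

(** Euclid's algorithm, by induction on a bound for the norm of [y]. *)
Lemma bezoutE (x y : eis) : exists d s t, [/\ d = s * x + t * y, dvdE d x & dvdE d y].
Proof.
have [n] := ubnP (absz (normE y)); elim: n x y => // n IH x y hn.
have [->|/eqP y0] := eqVneq y 0.
  by exists x, 1, 0; split; [ring | exists 1; ring | exists 0; ring].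
have [q hq] := eis_edivide x y y0.
have [|d [s [t [e [a ea] [b eb]]]]] := IH y (x - q * y).
  by move: (normE_ge0 (x - q * y)) hq hn; lia.
exists d, t, (s - t * q); split; first by rewrite e; ring.
  by exists (b + q * a); rewrite mulrDr mulrCA -ea -eb; ring.
by exists a.
Qed.

Lemma gcdE (x y : eis) : x <> 0 \/ y <> 0 -> exists d x1 y1,
  [/\ d <> 0, x = d * x1, y = d * y1 & coprE x1 y1].
Proof.
move=> h; have [d [s [t [e [a ea] [b eb]]]]] := bezoutE x y.
have d0 : d <> 0 by move=> d0; case: h; rewrite ?ea ?eb d0 mul0r.
exists d, a, b; split => //; exists s, t; apply: (mulE_cancel d) => //.
by rewrite mulr1 [RHS]e ea eb; ring.
Qed.

Lemma coprE_sym (x y : eis) : coprE x y -> coprE y x.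
Proof. by move=> [s [t e]]; exists t, s; rewrite addrC. Qed.
Lemma coprE_dvd (x y z : eis) : coprE x y -> dvdE z x -> coprE z y.
Proof. by move=> [s [t e]] [a ea]; exists (s * a), t; rewrite -e ea; ring. Qed.
Lemma coprEM (x y z : eis) : coprE x y -> coprE x z -> coprE x (y * z).
Proof.
move=> [s [t e]] [s' [t' e']].
exists (s * s' * x + s * t' * z + t * y * s'), (t * t').
by rewrite -[1]mulr1 -{1}e -e'; ring.
Qed.
Lemma gaussE (x y z : eis) : coprE x y -> dvdE x (y * z) -> dvdE x z.
Proof.
move=> [s [t e]] [a ea]; exists (s * z + t * a).
by rewrite -[LHS]mul1r -e mulrDr [x * (t * a)]mulrCA -ea; ring.
Qed.

(** * Coprime factors of a cube, and units that are ratios of cubes *)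

(* With d = gcd(x, z): modulo x, d^3 is a multiple of z^3, and since x^2 and y
   are coprime, x is a combination of x^3 and x y = z^3. *)
Lemma coprE_cube (x y z : eis) : coprE x y -> x * y = z ^+ 3 -> x <> 0 ->
  exists e d, normE e = 1 /\ x = e * d ^+ 3.
Proof.
move=> cxy exy x0; have [d [s [t [ed [a ea] [b eb]]]]] := bezoutE x z.
have [k [l ekl]] : coprE (x ^+ 2) y.
  by rewrite expr2; apply: coprE_sym; apply: coprEM; apply: coprE_sym.
have e1 : x = d ^+ 3 * (k * a ^+ 3 + l * b ^+ 3).
  have -> : d ^+ 3 * (k * a ^+ 3 + l * b ^+ 3) = k * (d * a) ^+ 3 + l * (d * b) ^+ 3 by ring.
  by rewrite -ea -eb -exy -[LHS]mulr1 -ekl; ring.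
have e2 : d ^+ 3 =
    x * (s ^+ 3 * x ^+ 2 + 3 * s ^+ 2 * x * t * z + 3 * s * t ^+ 2 * z ^+ 2 + t ^+ 3 * y).
  rewrite ed.
  have -> : (s * x + t * z) ^+ 3 =
      s ^+ 3 * x ^+ 3 + 3 * s ^+ 2 * x ^+ 2 * t * z + 3 * s * t ^+ 2 * x * z ^+ 2
      + t ^+ 3 * z ^+ 3 by ring.
  by rewrite -exy; ring.
move: e1 e2; set e := (k * _ + _); set f := (_ + t ^+ 3 * _) => e1 e2.
exists e, d; split; last by rewrite mulrC.
apply: (unit_norm _ f); apply: (mulE_cancel x) => //.
by rewrite mulr1 [e * f]mulrC mulrA -e2 -e1.
Qed.

(** In lowest terms the denominator [x1] is coprime to [z1] and divides [z1 ^+ 3], so it is a unit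
    with inverse [k], and e is the cube of [z1 * k]. *)
Lemma unit_cube (e x z : eis) : normE e = 1 -> x <> 0 -> e * x ^+ 3 = z ^+ 3 ->
  exists2 t, normE t = 1 & e = t ^+ 3.
Proof.
move=> ne x0 h; have [|d [x1 [z1 [d0 ex ez [s [t est]]]]]] := gcdE x z; first by left.
have h1 : e * x1 ^+ 3 = z1 ^+ 3.
  apply: (mulE_cancel (d ^+ 3)); first exact: cube_neq0.
  by rewrite -exprMn -ez -h ex; ring.
have [k ek] : dvdE x1 1.
  have c : coprE x1 z1 by exists s, t.
  apply: (@gaussE _ z1) => //; apply: (@gaussE _ z1) => //.
  apply: (@gaussE _ z1) => //; exists (e * x1 ^+ 2).
  by rewrite mulr1 -expr2 -exprS -h1; ring.
have e3 : e = (z1 * k) ^+ 3.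
  by rewrite exprMn -h1 -mulrA -exprMn -ek expr1n mulr1.
exists (z1 * k) => //.
have : normE (z1 * k) ^+ 3 = 1.
  by rewrite -ne e3 [in RHS]exprS [in RHS]expr2 !normM; ring.
move: (normE _) (normE_ge0 (z1 * k)) => n n0 hn.
by apply/eqP; rewrite -(@pexpr_eq1 _ _ 3) // hn.
Qed.

(** * Congruences modulo lambda, 3 and 9 *)

(** As omega is 1 modulo lambda and lambda divides 3, the residue of a + b omega is that of a + b
    modulo 3. *)
Lemma mod_lam (x : eis) : exists (t r : eis), x = r + lam * t /\ (r = 0 \/ r = 1 \/ r = -1).
Proof.
pose k := ((cre x + cw x) %/ 3)%Z.
have : exists r, (r = 0 \/ r = 1 \/ r = -1) /\ exists m, cre x + cw x = r + 3 * m.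
  have := divz_eq (cre x + cw x) 3.
  have : 0 <= ((cre x + cw x) %% 3)%Z < 3 by rewrite modz_ge0 ?ltz_pmod.
  move: (_ %/ _)%Z (_ %% _)%Z => q r hr e.
  have : r = 0 \/ r = 1 \/ r = 2 by lia.
  move=> [|[|]] h; [exists 0|exists 1|exists (-1)]; split; try (by tauto).
  - by exists q; lia.
  - by exists q; lia.
  - by exists (q+1); lia.
move=> [r [hr [m em]]].
exists (Eis (2 * m - cw x) m), (Eis r 0); split; last first.
  by case: hr => [->|[->|->]]; [left|right;left|right;right].
apply: eis_eq; rewrite !coordE /=; lia.
Qed.

Lemma lam2 : lam ^+ 2 = - (3 * omega).
Proof. by []. Qed.

(** Fermat's little theorem in the residue field of lambda, which has three elements. *)
Lemma cube_sub_lam (t : eis) : exists s, t ^+ 3 - t = lam * s.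
Proof.
have [k [r [-> hr]]] := mod_lam t.
exists (3 * r ^+ 2 * k + 3 * r * lam * k ^+ 2 + lam ^+ 2 * k ^+ 3 - k).
have : r ^+ 3 - r = 0 by move: hr => [|[|]] ->; ring.
by move=> h; rewrite -[LHS]subr0 -[in LHS]h; ring.
Qed.

(** Since lambda^2 = -3 omega and lambda^3 = -3 lambda - 9 omega, the linear and cubic terms of the
    expansion combine modulo 9 to -3 lambda (t^3 - t). As lambda divides t^3 - t, this is a multiple
    of 3 lambda^2, hence of 9. *)
Lemma cube_unit_mod9 (t : eis) : exists s : eis, (1 + lam * t) ^+ 3 = 1 + 9 * s.
Proof.
have [k ek] := cube_sub_lam t.
exists (omega * k - omega * t ^+ 2 - omega * t ^+ 3).
transitivity (1 + 3 * lam * t + 3 * lam ^+ 2 * t ^+ 2 + lam * lam ^+ 2 * t ^+ 3).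
  by ring.
rewrite lam2.
have -> : lam * - (3 * omega) = - (3 * lam) + 3 * lam ^+ 2 by [].
rewrite lam2.
transitivity (1 - 3 * lam * (t ^+ 3 - t) - 9 * omega * t ^+ 2 - 9 * omega * t ^+ 3).
  by ring.
rewrite ek.
transitivity (1 - 3 * lam ^+ 2 * k - 9 * omega * t ^+ 2 - 9 * omega * t ^+ 3).
  by ring.
by rewrite lam2; ring.
Qed.

Lemma cube_cases (x : eis) : (exists t, x = lam * t /\ x ^+ 3 = lam ^+ 3 * t ^+ 3) \/
  exists r s, (r = 1 \/ r = -1) /\ x ^+ 3 = r + 9 * s.
Proof.
have [t [r [-> hr]]] := mod_lam x; case: hr => [->|[->|->]].
- by left; exists t; rewrite add0r exprMn.
- by right; have [s es] := cube_unit_mod9 t; exists 1, s; split; [left|].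
- right; have [s es] := cube_unit_mod9 (- t); exists (-1), (- s); split; first by right.
  by transitivity (- (1 + lam * - t) ^+ 3); [ring | rewrite es; ring].
Qed.



(* A is congruent to 1 modulo lambda^3 but not modulo 9; here
   1 + 2 omega is a square root of -3. *)
Definition cubic_defect (A : eis) := exists (a : int) (C : eis),
  ~~ (3 %| a)%Z /\ A = 1 + 3 * Eis a 0 * (1 + 2 * omega) + 9 * C.

Lemma lam_nunit (t : eis) : lam * t = 1 -> False.
Proof. by move/unit_norm. Qed.

Lemma coprE_lam_dvd (x y : eis) : coprE x y -> dvdE lam x -> dvdE lam y -> False.
Proof.
move=> [s [t e]] [a ea] [b eb]; apply: (@lam_nunit (s * a + t * b)).
by rewrite -e ea eb; ring.
Qed.

(** A bounded integer residue turns the congruences below into linear integer arithmetic on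
    coordinates. For r = 0 only the modulus 3 is available, since 9 does not divide lambda^3. *)
Lemma cube_mod3 (x : eis) : exists (r : int) (s : eis),
  [/\ -1 <= r <= 1, x ^+ 3 = Eis r 0 + 3 * s, r = 0 -> dvdE lam x &
      r <> 0 -> exists s' : eis, x ^+ 3 = Eis r 0 + 9 * s'].
Proof.
have [[t [ex ex3]]|[r [s [[->|->] ex]]]] := cube_cases x.
- exists 0, (- omega * lam * t ^+ 3); split => //; last by exists t.
  have lam3 : lam ^+ 3 = 3 * (- omega * lam) by apply: eis_eq.
  by rewrite ex3 -[Eis 0 0]/(0 : eis) lam3; ring.
- exists 1, (3 * s); split => //; last by exists s.
  by rewrite ex -[Eis 1 0]/(1 : eis); ring.
- exists (-1), (3 * s); split => //; last by exists s.
  by rewrite ex -[Eis (-1) 0]/(-1 : eis); ring.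
Qed.

Lemma cubic_defect_not_mod9 (a r : int) (q : eis) : ~~ (3 %| a)%Z ->
  -1 <= r <= 1 -> r <> 0 -> Eis r 0 * (3 * Eis a 0 * (1 + 2 * omega)) <> 9 * q.
Proof.
move=> ha hr r0 /(congr1 cre); rewrite !coordE /=.
have [->|->] : r = 1 \/ r = -1 by lia.
  by lia.
by lia.
Qed.

(** Modulo 3, where A is 1, the coordinates give rx = ry = rz. If this residue is 0, lambda divides
    both y and z. Otherwise 1 + omega + omega^2 = 0 leaves rx (A - 1) = 0 modulo 9, against the
    defect of A. *)
Lemma distinct_twists_no_sol (A x y z : eis) : cubic_defect A -> coprE y z ->
  A * x ^+ 3 + omega * y ^+ 3 + omega ^+ 2 * z ^+ 3 = 0 -> False.
Proof.
move=> [a [C [ha eA]]] cyz eqn.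
have [rx [sx [hx ex lx mx]]] := cube_mod3 x.
have [ry [sy [hy ey ly my]]] := cube_mod3 y.
have [rz [sz [hz ez lz mz]]] := cube_mod3 z.
have [exy exz] : rx = ry /\ rx = rz.
  have e : Eis rx 0 + omega * Eis ry 0 + omega ^+ 2 * Eis rz 0 =
      3 * - (Eis a 0 * (1 + 2 * omega) * x ^+ 3 + 3 * C * x ^+ 3
        + sx + omega * sy + omega ^+ 2 * sz).
    rewrite -[LHS]subr0 -eqn eA ey ez mulrDl mulrDl mul1r ex; ring.
  move: e; set q := - _; rewrite (_ : omega ^+ 2 = Eis (-1) (-1)) // => e.
  have := congr1 cre e; have := congr1 cw e; rewrite !coordE /=; lia.
subst ry rz.
have [r0|/eqP r0] := eqVneq rx 0; first by apply: (coprE_lam_dvd _ _ cyz); auto.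
have [qx fx] := mx r0; have [qy fy] := my r0; have [qz fz] := mz r0.
apply: (cubic_defect_not_mod9 a rx
  (- (Eis rx 0 * C + A * qx + omega * qy + omega ^+ 2 * qz))) => //.
rewrite -[LHS]subr0 -eqn fx fy fz.
rewrite (_ : 3 * Eis a 0 * (1 + 2 * omega) = A - (1 + 9 * C)); last by rewrite eA; ring.
by rewrite (_ : omega ^+ 2 = - 1 - omega) //; ring.
Qed.

(** If lambda divided none of them, all three cubes would be 1 or -1 modulo 9; the omega coordinate
    of the equation would then be 6 a rx modulo 9, which is not 0. *)
Lemma lam_dvd_sol (A x y z : eis) : cubic_defect A ->
  A * x ^+ 3 + y ^+ 3 + z ^+ 3 = 0 -> [\/ dvdE lam x, dvdE lam y | dvdE lam z].
Proof.
move=> [a [C [ha eA]]] eqn.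
have [rx [sx [hx _ lx mx]]] := cube_mod3 x.
have [ry [sy [hy _ ly my]]] := cube_mod3 y.
have [rz [sz [hz _ lz mz]]] := cube_mod3 z.
have [r0|/eqP r0] := eqVneq rx 0; first by constructor 1; auto.
have [ry0|/eqP ry0] := eqVneq ry 0; first by constructor 2; auto.
have [rz0|/eqP rz0] := eqVneq rz 0; first by constructor 3; auto.
have [qx fx] := mx r0; have [qy fy] := my ry0; have [qz fz] := mz rz0.
have e : Eis rx 0 * (3 * Eis a 0 * (1 + 2 * omega)) + Eis rx 0 + Eis ry 0 + Eis rz 0 =
    9 * - (Eis rx 0 * C + A * qx + qy + qz).
  rewrite -[LHS]subr0 -eqn fx fy fz.
  by rewrite (_ : 3 * Eis a 0 * (1 + 2 * omega) = A - (1 + 9 * C)); [ring | rewrite eA; ring].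
exfalso; move: (congr1 cw e); rewrite !coordE /=.
have [->|->] : rx = 1 \/ rx = -1 by lia.
  by lia.
by lia.
Qed.

Lemma lam_dvd_cube (x : eis) : dvdE lam (x ^+ 3) -> dvdE lam x.
Proof.
move=> [t]; have [[s [-> _]] _|[r [s [hr ->]]] h] := cube_cases x; first by exists s.
case: (@lam_nunit (r * (t - lam * (3 + 3 * omega) * s))).
have e : 9 = lam * lam * (3 + 3 * omega) by apply: eis_eq.
transitivity (r * (r + 9 * s) - 9 * s * r); first by rewrite h e; ring.
by case: hr => ->; ring.
Qed.

(** * One step of the descent *)

Lemma coprEX (x y : eis) n : coprE x y -> coprE (x ^+ n) y.
Proof.
move=> h; elim: n => [|n IH]; first by exists 1, 0; rewrite expr0; ring.
by rewrite exprS; apply: coprE_sym; apply: coprEM; apply: coprE_sym.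
Qed.

Lemma unit6 (t : eis) : normE t = 1 -> t ^+ 6 = 1.
Proof.
move=> /norm1_cases [s [k [hk hs ->]]].
rewrite exprMn -!exprM (_ : 3 * 6 = 2 * 9)%N // exprM hs expr1n mul1r.
by move: k hk => [|[|[|]]] //.
Qed.

(** As f2 and f3 are coprime to P, all of A divides f1, and f1 / A, f2, f3 are pairwise coprime with
    product w^3. The last equation of the conclusion serves to compare norms. *)
Lemma cube_descent_step_of_dvd (P A f1 f2 f3 w : eis) k :
  A = P ^+ k -> cubic_defect A -> dvdE P f1 ->
  f1 + f2 + f3 = 0 -> f1 * f2 * f3 = A * w ^+ 3 -> A <> 0 -> w <> 0 ->
  coprE f1 f2 -> coprE f1 f3 -> coprE f2 f3 ->
  exists x y z e, [/\ y ^+ 3 + z ^+ 3 = A * x ^+ 3, coprE y z, normE e = 1 &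
    e * (x * y * z) ^+ 3 = w ^+ 3].
Proof.
move=> eA dA Pf1 sum prod A0 w0 c12 c13 c23.
have cA f : coprE f1 f -> coprE A f.
  by move=> c; rewrite eA; apply: coprEX; apply: coprE_dvd Pf1.
have [g eg] : dvdE A f1.
  apply: (@gaussE _ (f2 * f3)); first by apply: coprEM; apply: cA.
  by exists (w ^+ 3); rewrite -prod; ring.
have gf1 : dvdE g f1 by exists A; rewrite mulrC.
have cg2 := coprE_dvd _ _ _ c12 gf1; have cg3 := coprE_dvd _ _ _ c13 gf1.
have prod' : g * f2 * f3 = w ^+ 3.
  by apply: (mulE_cancel A) => //; rewrite -prod eg; ring.
have w30 := cube_neq0 _ w0.
have g0 : g <> 0 by move=> h; apply: w30; rewrite -prod' h; ring.
have f20 : f2 <> 0 by move=> h; apply: w30; rewrite -prod' h; ring.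
have f30 : f3 <> 0 by move=> h; apply: w30; rewrite -prod' h; ring.
have [e1 [x [ne1 ex]]] : exists e d, normE e = 1 /\ g = e * d ^+ 3.
  by apply: (@coprE_cube _ (f2 * f3) w) => //; [apply: coprEM | rewrite -prod'; ring].
have [e2 [y [ne2 ey]]] : exists e d, normE e = 1 /\ f2 = e * d ^+ 3.
  apply: (@coprE_cube _ (g * f3) w) => //; last by rewrite -prod'; ring.
  by apply: coprEM => //; apply: coprE_sym.
have [e3 [z [ne3 ez]]] : exists e d, normE e = 1 /\ f3 = e * d ^+ 3.
  apply: (@coprE_cube _ (g * f2) w) => //; last by rewrite -prod'; ring.
  by apply: coprEM; apply: coprE_sym.
have ne : normE (e1 * e2 * e3) = 1 by rewrite !normM ne1 ne2 ne3.
have xyz : e1 * e2 * e3 * (x * y * z) ^+ 3 = w ^+ 3 by rewrite -prod' ex ey ez; ring.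
have xyz0 : x * y * z <> 0 by move=> h; apply: w30; rewrite -xyz h; ring.
have [t nt et] := unit_cube _ _ _ ne xyz0 xyz.
have yz : coprE y z.
  have c : coprE y f3 by apply: coprE_dvd c23 _; exists (e2 * y ^+ 2); rewrite ey; ring.
  apply: coprE_sym; apply: coprE_dvd (coprE_sym _ _ c) _.
  by exists (e3 * z ^+ 2); rewrite ez; ring.
have [s1 [k1 [hk1 hs1 es1]]] := norm1_cases _ ne1.
have [s2 [k2 [hk2 hs2 es2]]] := norm1_cases _ ne2.
have [s3 [k3 [hk3 hs3 es3]]] := norm1_cases _ ne3.
(* The product of the units is a cube [t ^+ 3] with [t ^+ 6 = 1]; squaring removes the signs and
   leaves that 3 divides k1 + k2 + k3. *)
have hk : omega ^+ (k1 * 2 + k2 * 2 + k3 * 2) = 1.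
  have c (s o : eis) : s ^+ 2 = 1 -> (s ^+ 3 * o) ^+ 2 = o ^+ 2.
    by move=> h; transitivity ((s ^+ 2) ^+ 3 * o ^+ 2); [ring | rewrite h expr1n mul1r].
  transitivity ((e1 * e2 * e3) ^+ 2); last by rewrite et -exprM unit6.
  rewrite !exprD !exprM es1 es2 es3.
  rewrite -(c _ (omega ^+ k1) hs1) -(c _ (omega ^+ k2) hs2) -(c _ (omega ^+ k3) hs3).
  ring.
have yz' : coprE (s2 * y) (s3 * z).
  have [u [v e]] := yz; exists (u * s2), (v * s3).
  rewrite -e -[in RHS](mulr1 u) -[in RHS](mulr1 v).
  by rewrite -{1}hs2 -hs3; ring.
have eqn : A * (omega ^+ k1 * (s1 * x) ^+ 3)
    + omega ^+ k2 * (s2 * y) ^+ 3 + omega ^+ k3 * (s3 * z) ^+ 3 = 0.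
  by rewrite -sum eg ex ey ez es1 es2 es3; ring.
(* By the condition on their sum, the exponents are all equal or all distinct. If distinct,
   multiplication by a power of omega gives coefficient 1 to the term in A, and omega and omega^2 to
   the others, up to exchanging them. *)
have key : k1 = k2 /\ k1 = k3.
  have om3 m : omega ^+ (m + 3) = omega ^+ m by rewrite exprD mulr1.
  have scaled j l m : omega ^+ k1 * omega ^+ j = 1 -> 
    omega ^+ k2 * omega ^+ j = omega ^+ l -> omega ^+ k3 * omega ^+ j = omega ^+ m ->
    A * (s1 * x) ^+ 3 + omega ^+ l * (s2 * y) ^+ 3 + omega ^+ m * (s3 * z) ^+ 3 = 0.
    move=> hj hl hm; rewrite -[RHS](mulr0 (omega ^+ j)) -eqn -hl -hm.
    by rewrite -[X in X * (s1 * x) ^+ 3]mulr1 -hj; ring.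
  have no12 := distinct_twists_no_sol A (s1 * x) (s2 * y) (s3 * z) dA yz'.
  have no21 := distinct_twists_no_sol A (s1 * x) (s3 * z) (s2 * y) dA (coprE_sym _ _ yz').
  have {}no12 j : omega ^+ k1 * omega ^+ j = 1 -> 
    omega ^+ k2 * omega ^+ j = omega ^+ 1 -> omega ^+ k3 * omega ^+ j = omega ^+ 2 -> False.
    by move=> a b c; apply: no12; rewrite -(scaled j 1%N 2%N a b c).
  have {}no21 j : omega ^+ k1 * omega ^+ j = 1 -> 
    omega ^+ k2 * omega ^+ j = omega ^+ 2 -> omega ^+ k3 * omega ^+ j = omega ^+ 1 -> False.
    by move=> a b c; apply: no21; rewrite -(scaled j 2%N 1%N a b c) addrAC.
  move: hk1 hk2 hk3 hk no12 no21; clear.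
  move: k1 k2 k3 => [|[|[|//]]] [|[|[|//]]] [|[|[|//]]] _ _ _ // hk no12 no21.
  all: try (by have := congr1 cre hk).
  all: try (by case: (no12 0%N)).
  all: try (by case: (no12 1%N)).
  all: try (by case: (no12 2%N)).
  all: try (by case: (no21 0%N)).
  all: try (by case: (no21 1%N)).
  all: try (by case: (no21 2%N)).
case: key hk eqn => <- <- hk eqn.
(* The factor [- (s1 * s2 * s3)] of the unit cancels the cubed signs, because each [s] has fourth
   power 1. *)
exists (- (s1 * x)), (s2 * y), (s3 * z), (e1 * e2 * e3 * - (s1 * s2 * s3)).
split => //.
- have h : omega ^+ k1 * (A * (s1 * x) ^+ 3 + (s2 * y) ^+ 3 + (s3 * z) ^+ 3) = 0.
    by rewrite -eqn; ring.
  case: (mulE_eq0 _ _ h) => [h0|h0].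
    move: hk1 h0; clear; move: k1 => [|[|[|]]] // _ h;
      by have := congr1 cre h; have := congr1 cw h.
  have -> : A * (- (s1 * x)) ^+ 3 = (s2 * y) ^+ 3 + (s3 * z) ^+ 3
      - (A * (s1 * x) ^+ 3 + (s2 * y) ^+ 3 + (s3 * z) ^+ 3) by ring.
  by rewrite h0 subr0.
- have u (s : eis) : s ^+ 2 = 1 -> normE s = 1 by rewrite expr2 => /unit_norm.
  by rewrite normM ne -mulN1r !normM (u _ hs1) (u _ hs2) (u _ hs3).
- have q (s : eis) : s ^+ 2 = 1 -> s * s ^+ 3 = 1.
    by move=> h; rewrite -exprS (exprM s 2 2) h expr1n.
  have -> : e1 * e2 * e3 * - (s1 * s2 * s3) * (- (s1 * x) * (s2 * y) * (s3 * z)) ^+ 3 =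
    (s1 * s1 ^+ 3) * (s2 * s2 ^+ 3) * (s3 * s3 ^+ 3) * (e1 * e2 * e3 * (x * y * z) ^+ 3) by ring.
  by rewrite xyz !q //; ring.
Qed.


(** The norm of the gcd divides p. If it is 1, the gcd is a unit; if it is p, the cofactor of the
    gcd in P is a unit. *)
Lemma coprE_or_dvd (P f : eis) (p : nat) : prime p -> normE P = p -> coprE P f \/ dvdE P f.
Proof.
move=> pp nP; have [d [s [t [e [a ea] [b eb]]]]] := bezoutE P f.
have h : normE d * normE a = p by rewrite -normM -ea.
have unit_of (x : eis) : absz (normE x) = 1%N -> x * conjE x = 1.
  by move=> nx; apply: norm1_unit; move: (normE_ge0 x) nx; lia.
have : (absz (normE d) %| p)%N by apply/dvdnP; exists (absz (normE a)); rewrite mulnC -abszM h.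
case/primeP: (pp) => _ /[apply] /orP [] /eqP nd.
  left; exists (conjE d * s), (conjE d * t).
  by transitivity (conjE d * (s * P + t * f)); [ring | rewrite -e mulrC unit_of].
right; exists (conjE a * b); rewrite eb ea.
have -> : d * a * (conjE a * b) = d * (a * conjE a) * b by ring.
rewrite unit_of ?mulr1 //.
have : p = (absz (normE d) * absz (normE a))%N by rewrite -abszM h.
by rewrite nd; have := prime_gt0 pp; nia.
Qed.

(** If P were coprime to all three factors, it would be coprime to their product, which it divides
    as k > 0. So P divides one of them, and that factor is moved to the front. *)
Lemma cube_descent_step (P A f1 f2 f3 w : eis) k (p : nat) : prime p -> normE P = p ->
  (0 < k)%N -> A = P ^+ k -> cubic_defect A ->
  f1 + f2 + f3 = 0 -> f1 * f2 * f3 = A * w ^+ 3 -> A <> 0 -> w <> 0 ->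
  coprE f1 f2 -> coprE f1 f3 -> coprE f2 f3 ->
  exists x y z e, [/\ y ^+ 3 + z ^+ 3 = A * x ^+ 3, coprE y z, normE e = 1 &
    e * (x * y * z) ^+ 3 = w ^+ 3].
Proof.
move=> pp nP k0 eA dA sum prod A0 w0 c12 c13 c23.
have [c1|d1] := coprE_or_dvd P f1 p pp nP; last first.
  by apply: (cube_descent_step_of_dvd P A f1 f2 f3 w k).
have [c2|d2] := coprE_or_dvd P f2 p pp nP; last first.
  apply: (cube_descent_step_of_dvd P A f2 f1 f3 w k) => //; first by rewrite -sum; ring.
    by rewrite -prod; ring.
  exact: coprE_sym.
have [c3|d3] := coprE_or_dvd P f3 p pp nP; last first.
  apply: (cube_descent_step_of_dvd P A f3 f1 f2 w k) => //; try exact: coprE_sym.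
    by rewrite -sum; ring.
  by rewrite -prod; ring.
have [s h] : dvdE P 1.
  apply: (@gaussE _ (f1 * f2 * f3)); first by do 2!apply: coprEM => //.
  by rewrite mulr1 prod eA -(prednK k0) exprS; exists (P ^+ k.-1 * w ^+ 3); ring.
by have := unit_norm _ _ (esym h); rewrite nP => /eqP; move: pp; case: (p) => [|[|]].
Qed.

(** * The three linear factors of a sum of two cubes, and the infinite descent *)

(** Cramer's rule: the ideal of f and g contains the determinant times x and times y, hence the
    determinant itself. In the applications D is a unit. *)
Lemma lam_in_linear_span (a b c d x y f g D : eis) : coprE x y ->
  f = a * x + b * y -> g = c * x + d * y ->
  (a * d - b * c) * D = lam -> exists S T, S * f + T * g = lam.
Proof.
move=> [s [t e]] -> -> <-; exists (D * (s * d - t * c)), (D * (t * a - s * b)).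
by rewrite -[RHS]mulr1 -e; ring.
Qed.

Lemma coprE_of_lam_mod (f g S T r t : eis) :
  S * f + T * g = lam -> r * f + t * lam = 1 -> coprE f g.
Proof. by move=> <- h; exists (r + t * S), (t * T); rewrite -h; ring. Qed.

Lemma lam_neq0 : lam <> 0.
Proof. by move/(congr1 cre). Qed.

Lemma coprE_of_lam_mul (f g S T : eis) : S * (lam * f) + T * (lam * g) = lam -> coprE f g.
Proof.
move=> h; exists S, T; apply: (mulE_cancel lam); first exact: lam_neq0.
by rewrite mulr1 -[RHS]h; ring.
Qed.

(** A is 1 modulo 3, and 3 = lambda (1 - omega^2). *)
Lemma coprE_lam_defect A : cubic_defect A -> coprE lam A.
Proof.
move=> [a [C [ha ->]]].
exists (- (1 - omega ^+ 2) * (Eis a 0 * (1 + 2 * omega) + 3 * C)), 1.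
have -> : - (1 - omega ^+ 2) * (Eis a 0 * (1 + 2 * omega) + 3 * C) * lam =
    - (lam * (1 - omega ^+ 2)) * (Eis a 0 * (1 + 2 * omega) + 3 * C) by ring.
have -> : lam * (1 - omega ^+ 2) = 3 by apply: eis_eq.
ring.
Qed.

Lemma coprime_sum_two_cubes_eq0 (P A : eis) k (p n : nat) :
  prime p -> normE P = p -> (0 < k)%N ->
  A = P ^+ k -> cubic_defect A -> A <> 0 ->
  forall x y z : eis, (absz (normE z) < n)%N -> coprE x y ->
    x ^+ 3 + y ^+ 3 = A * z ^+ 3 -> z = 0.
Proof.
move=> pp nP k0 eA dA A0; elim: n => // n IH x y z hn cxy eqn.
have [//|/eqP z0] := eqVneq z 0; exfalso.
set f1 := x + y; set f2 := omega * x + omega ^+ 2 * y; set f3 := omega ^+ 2 * x + omega * y.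
have om2 : omega ^+ 2 = - 1 - omega by apply: eis_eq.
have sum : f1 + f2 + f3 = 0 by rewrite /f1 /f2 /f3 om2; ring.
have prod : f1 * f2 * f3 = A * z ^+ 3.
  have om3 : omega ^+ 3 = 1 by apply: eis_eq.
  rewrite -eqn /f1 /f2 /f3.
  transitivity ((x + y) * (omega ^+ 3 * x ^+ 2
    + omega ^+ 2 * (omega ^+ 2 + 1) * x * y + omega ^+ 3 * y ^+ 2)); first by ring.
  have -> : omega ^+ 2 * (omega ^+ 2 + 1) = -1 by apply: eis_eq.
  by rewrite om3; ring.
have [S12 [T12 h12]] : exists S T, S * f1 + T * f2 = lam.
  apply: (@lam_in_linear_span 1 1 omega (omega ^+ 2) x y _ _ (- omega ^+ 2)) => //.
  by rewrite /f1 !mul1r.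
have [S13 [T13 h13]] : exists S T, S * f1 + T * f3 = lam.
  apply: (@lam_in_linear_span 1 1 (omega ^+ 2) omega x y _ _ (omega ^+ 2)) => //.
  by rewrite /f1 !mul1r.
have [S23 [T23 h23]] : exists S T, S * f2 + T * f3 = lam.
  by apply: (@lam_in_linear_span omega (omega ^+ 2) (omega ^+ 2) omega x y _ _ (- omega ^+ 2)).
(* The powers of omega agree modulo lambda, so the three factors do too: lambda divides all of them
   or none. *)
have e2 : f2 = f1 - lam * (x + (1 + omega) * y).
  rewrite /f1 /f2 om2 (_ : lam = 1 - omega) //.
  by transitivity (x + y - (1 - omega) * x - (1 - omega ^+ 2) * y); [rewrite om2; ring | ring].
have e3 : f3 = f1 - lam * ((1 + omega) * x + y).
  rewrite /f1 /f3 om2 (_ : lam = 1 - omega) //.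
  by transitivity (x + y - (1 - omega) * y - (1 - omega ^+ 2) * x); [rewrite om2; ring | ring].
have [t [r [ef1 hr]]] := mod_lam f1.
have [r0|rn0] : r = 0 \/ r * r = 1 by case: hr => [|[|]] ->; auto; right; ring.
  have g1 : f1 = lam * t by rewrite ef1 r0 add0r.
  have g2 : f2 = lam * (t - (x + (1 + omega) * y)) by rewrite e2 g1; ring.
  have g3 : f3 = lam * (t - ((1 + omega) * x + y)) by rewrite e3 g1; ring.
  move: h12 h13 h23 sum prod; rewrite g1 g2 g3.
  set u2 := t - _; set u3 := t - _ => h12 h13 h23 sum prod.
  (* Here lambda divides all three factors, hence z; the step is applied to the factors divided by
     lambda and to w = z / lambda. *)
  have [w ew] : dvdE lam z.
    apply: lam_dvd_cube; apply: (@gaussE _ A); first exact: coprE_lam_defect.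
    by exists (t * (lam * u2) * (lam * u3)); rewrite -prod; ring.
  have w0 : w <> 0 by move=> w0; apply: z0; rewrite ew w0 mulr0.
  have [||x' [y' [z' [e [eqn' c' ne ex']]]]] :=
    cube_descent_step P A t u2 u3 w k p pp nP k0 eA dA _ _ A0 w0
      (coprE_of_lam_mul _ _ _ _ h12) (coprE_of_lam_mul _ _ _ _ h13)
      (coprE_of_lam_mul _ _ _ _ h23).
  - by apply: (mulE_cancel lam); [exact: lam_neq0 | rewrite mulr0 -[RHS]sum; ring].
  - apply: (mulE_cancel (lam ^+ 3)); first exact: cube_neq0 lam_neq0.
    transitivity (A * z ^+ 3); [rewrite -prod | rewrite ew]; ring.
  have x0 : x' <> 0.
    by move=> h; apply: (cube_neq0 _ w0); rewrite -ex' h; ring.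
  apply: x0; apply: (IH y' z') => //.
  (* N(x') divides N(w), and N(z) = 3 N(w), so the new solution is strictly smaller. *)
  have nw : normE x' * normE (y' * z') = normE w.
    have := congr1 normE ex'; rewrite normM ne mul1r.
    have nc (s : eis) : normE (s ^+ 3) = normE s ^+ 3.
      by rewrite !exprS expr0 mulr1 !normM !mulr1.
    rewrite !nc => /eqP; rewrite eqrXn2 ?normE_ge0 // => /eqP <-.
    by rewrite -normM mulrA.
  have := normE_gt0 _ w0; rewrite -nw.
  have nz : normE z = 3 * normE w by rewrite ew normM.
  move: hn; rewrite nz -nw.
  move: (normE x') (normE (y' * z')) (normE_ge0 x') (normE_ge0 (y' * z')) => a b ha hb hn ab.
  have b0 : b != 0 by apply/eqP => h; move: ab; rewrite h mulr0.
  have : a <= a * b by nia.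
  by lia.
(* Now r is 1 or -1, and is its own inverse: every factor is invertible modulo lambda. *)
have d1 : r * f1 + - r * t * lam = 1 by rewrite ef1 -rn0; ring.
have d2 : r * f2 + r * (x + (1 + omega) * y - t) * lam = 1 by rewrite e2 ef1 -rn0; ring.
have d3 : r * f3 + r * ((1 + omega) * x + y - t) * lam = 1 by rewrite e3 ef1 -rn0; ring.
have [x' [y' [z' [e [eqn' c' ne ex']]]]] :=
  cube_descent_step P A f1 f2 f3 z k p pp nP k0 eA dA sum prod A0 z0
  (coprE_of_lam_mod _ _ _ _ _ _ h12 d1) (coprE_of_lam_mod _ _ _ _ _ _ h13 d1)
  (coprE_of_lam_mod _ _ _ _ _ _ h23 d2).
(* Lambda divides one of x', y', z', hence the product of the three factors, to which it is
   coprime. *)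
have [q eq] : dvdE lam (z ^+ 3).
  have eqn0 : A * (- x') ^+ 3 + y' ^+ 3 + z' ^+ 3 = 0.
    by transitivity (y' ^+ 3 + z' ^+ 3 - A * x' ^+ 3); [ring | rewrite eqn' subrr].
  rewrite -ex'; case: (lam_dvd_sol _ _ _ _ dA eqn0) => -[q hq].
  - exists (e * lam ^+ 2 * (- q * y' * z') ^+ 3).
    by rewrite -[x']opprK hq; ring.
  - by exists (e * lam ^+ 2 * (x' * q * z') ^+ 3); rewrite hq; ring.
  - by exists (e * lam ^+ 2 * (x' * y' * q) ^+ 3); rewrite hq; ring.
have [s es] : dvdE lam 1.
  have cl f r' t' : r' * f + t' * lam = 1 -> coprE lam f.
    by move=> h; exists t', r'; rewrite addrC.
  apply: (@gaussE _ (f1 * f2 * f3)).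
    by apply: coprEM; [apply: coprEM|]; apply: cl; eassumption.
  by exists (A * q); rewrite mulr1 prod eq; ring.
exact: lam_nunit (esym es).
Qed.

(** Reduction to coprime x and y: their gcd d is divided out, and then the common factor g of d and
    z. What remains of d is [d1], whose cube divides A. *)
Lemma sum_two_cubes_eq0 (P A : eis) k (p : nat) : prime p -> normE P = p -> (0 < k < 3)%N ->
  A = P ^+ k -> cubic_defect A ->
  forall x y z : eis, x ^+ 3 + y ^+ 3 = A * z ^+ 3 -> z = 0.
Proof.
move=> pp nP /andP [k0 k3] eA dA x y z eqn.
have nA : normE A = (p ^ k)%N.
  rewrite eA; elim: (k) => // m IH; rewrite exprS normM IH nP expnS PoszM //.
have A0 : A <> 0.
  move=> h; have : (p ^ k = 0)%N by move: nA; rewrite h => -[].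
  by move/eqP; rewrite expn_eq0; have := prime_gt0 pp; lia.
have [//|/eqP z0] := eqVneq z 0; exfalso.
have xy0 : x <> 0 \/ y <> 0.
  have [x0|/eqP] := eqVneq x 0; last by left.
  have [y0|/eqP] := eqVneq y 0; last by right.
  have : A * z ^+ 3 = 0 by rewrite -eqn x0 y0; ring.
  by case/mulE_eq0 => // h; case: (cube_neq0 _ z0 h).
have [d [x1 [y1 [d0 ex ey cxy]]]] := gcdE x y xy0.
have [g [d1 [z1 [g0 ed ez cdz]]]] := gcdE d z (or_introl d0).
have e1 : d1 ^+ 3 * (x1 ^+ 3 + y1 ^+ 3) = A * z1 ^+ 3.
  apply: (mulE_cancel (g ^+ 3)); first exact: cube_neq0.
  transitivity (A * z ^+ 3); [rewrite -eqn ex ey ed | rewrite ez]; ring.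
have [m em] : dvdE (d1 ^+ 3) A.
  apply: (@gaussE _ (z1 ^+ 3)); last by exists (x1 ^+ 3 + y1 ^+ 3); rewrite e1 mulrC.
  by apply: coprEX; apply: coprE_sym; apply: coprEX; apply: coprE_sym.
(* N(d1)^3 divides p^k, so a prime factor of N(d1) would be p and p^3 would divide p^k, against k <
   3. *)
have nd : normE d1 = 1.
  have h : (absz (normE d1) ^ 3 %| p ^ k)%N.
    apply/dvdnP; exists (absz (normE m)).
    have -> : (p ^ k)%N = absz (normE A) by rewrite nA.
    by rewrite em normM abszM mulnC !exprS expr0 mulr1 !normM !abszM mulnA.
  have [n1|n1] := eqVneq (absz (normE d1)) 1%N; first by move: (normE_ge0 d1) n1; lia.
  have qp := pdiv_prime (n := absz (normE d1)).
  have n2 : (1 < absz (normE d1))%N.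
    have : (0 < absz (normE d1) ^ 3)%N by apply: dvdn_gt0 h; rewrite expn_gt0 prime_gt0.
    by rewrite expn_gt0 orbF => h0; lia.
  have {}qp := qp n2.
  have q3 : (pdiv (absz (normE d1)) ^ 3 %| p ^ k)%N.
    by apply: dvdn_trans h; rewrite dvdn_exp2r // pdiv_dvd.
  have : (pdiv (absz (normE d1)) %| p ^ k)%N by apply: dvdn_trans q3; apply: dvdn_exp.
  rewrite Euclid_dvdX // => /andP [+ _]; rewrite dvdn_prime2 // => /eqP qe.
  by move: q3; rewrite qe dvdn_Pexp2l ?prime_gt1 //; lia.
have ud := norm1_unit _ nd.
have : z1 * conjE d1 = 0.
  apply: (coprime_sum_two_cubes_eq0 P A k p (absz (normE (z1 * conjE d1))).+1
    pp nP k0 eA dA A0 x1 y1) => //.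
  rewrite exprMn mulrA -e1; transitivity ((d1 * conjE d1) ^+ 3 * (x1 ^+ 3 + y1 ^+ 3)); last by ring.
  by rewrite ud expr1n mul1r.
case/mulE_eq0 => [h|h]; first by apply: z0; rewrite ez h mulr0.
by move: ud; rewrite h mulr0 => /(congr1 cre).
Qed.


(** * The cubic defect of pi and of its square *)

Lemma cubic_defect_sqr (A : eis) : cubic_defect A -> cubic_defect (A ^+ 2).
Proof.
move=> [a [C [ha ->]]]; rewrite /cubic_defect; move: (1 + 2 * omega) => th.
exists (2 * a), (Eis a 0 ^+ 2 * th ^+ 2 + 2 * C + 6 * Eis a 0 * th * C + 9 * C ^+ 2).
split; first by lia.
have -> : Eis (2 * a) 0 = 2 * Eis a 0 by apply: eis_eq; rewrite !coordE /=; ring.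
ring.
Qed.

(** For P = 1 + 3(a + b omega) the norm is 1 + 3(2a - b) modulo 9, so p = 1 modulo 9 forces b = 2a
    modulo 3. If 3 divided a, P would be 1 modulo 9. *)
Lemma cubic_defect_norm (P : eis) (p : nat) : normE P = p -> (p = 1 %[mod 9])%N ->
  dvdE 3 (P - 1) -> ~ dvdE 9 (P - 1) -> cubic_defect P.
Proof.
move=> nP hp [[a b] e3] n9.
have eP : P = 1 + 3 * Eis a b by rewrite -e3; ring.
have [c ec] : exists c, b = 2 * a + 3 * c.
  have [m em] : exists m : int, p = 1 + 9 * m :> int by exists (p %/ 9)%N%:Z; lia.
  exists (a ^+ 2 - a * b + b ^+ 2 - m).
  by move: nP; rewrite eP em /normE !coordE /=; lia.
exists a, (Eis 0 c); split.
  apply/negP => /dvdzP [k ek]; apply: n9; exists (Eis k (2 * k + c)).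
  by rewrite eP; apply: eis_eq; rewrite !coordE /=; lia.
by rewrite eP ec; apply: eis_eq; rewrite !coordE /=; lia.
Qed.

(** * Transfer between the coordinates and the subsets O and K of the field *)

Section Embedding.
Variables (C : numFieldType) (u v : C).
Hypothesis root_u : u ^+ 2 = - 1 - u.
Hypothesis def_v : v = - 1 - u.

Definition evalE (x : eis) : C := (cre x)%:~R + (cw x)%:~R * u.

Lemma evalD (x y : eis) : evalE (x + y) = evalE x + evalE y.
Proof. by rewrite /evalE !coordE !intrD; ring. Qed.
Lemma evalM (x y : eis) : evalE (x * y) = evalE x * evalE y.
Proof.
rewrite /evalE !coordE !(intrD, intrM, intrN) -[RHS]addr0.
(* The added zero is a multiple of the relation satisfied by u, after which the identity is a
   polynomial one. *)
rewrite -[X in _ = _ + X](mulr0 (- (cw x)%:~R * (cw y)%:~R)) -(subrr (u ^+ 2)) {2}root_u.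
ring.
Qed.
Lemma evalX (x : eis) n : evalE (x ^+ n) = evalE x ^+ n.
Proof.
elim: n => [|n IH]; last by rewrite !exprS evalM IH.
by rewrite !expr0 /evalE mul0r addr0.
Qed.
Lemma eval_int (n : int) : evalE (Eis n 0) = n%:~R.
Proof. by rewrite /evalE mul0r addr0. Qed.
Lemma evalB (x y : eis) : evalE (x - y) = evalE x - evalE y.
Proof. by rewrite /evalE !coordE !intrD !intrN; ring. Qed.
Lemma eval_norm (x : eis) : evalE x * evalE (conjE x) = (normE x)%:~R.
Proof. by rewrite -evalM mulE_conj eval_int. Qed.
Lemma eval_inj x y : evalE x = evalE y -> x = y.
Proof.
move=> h; have : evalE (x - y) = 0 by rewrite evalB h subrr.
move=> h0; have := eval_norm (x - y); rewrite h0 mul0r => /esym/eqP.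
by rewrite intr_eq0 => /eqP /normE_eq0 /eqP; rewrite subr_eq0 => /eqP.
Qed.

Lemma inO_eval x : inO u v x <-> exists X, x = evalE X.
Proof.
split=> [[a [b [c ->]]]|[X ->]].
  by exists (Eis (a - c) (b - c)); rewrite /evalE /= !intrB def_v; ring.
by exists (cre X), (cw X), 0; rewrite mul0r addr0.
Qed.

Lemma dvdO_eval (X Y : eis) : dvdO u v (evalE X) (evalE Y) <-> dvdE X Y.
Proof.
split=> [[t /inO_eval [T ->]]|[T ->]].
  by rewrite -evalM => /eval_inj ->; exists T.
by exists (evalE T); [apply/inO_eval; exists T | rewrite evalM].
Qed.

Lemma inK_eval x : inK u v x -> exists (m : int) X, m != 0 /\ m%:~R * x = evalE X.
Proof.
move=> [a [b [c ->]]].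
have ratE (q : rat) : (denq q)%:~R * ratr q = (numq q)%:~R :> C.
  by rewrite /ratr mulrC divfK // intr_eq0 denq_neq0.
exists (denq a * denq b * denq c),
  (Eis (numq a * denq b * denq c - numq c * denq a * denq b)
       (numq b * denq a * denq c - numq c * denq a * denq b)).
split; first by rewrite !mulf_neq0 ?denq_neq0.
by rewrite /evalE /= !(intrB, intrM) -!ratE def_v; ring.
Qed.

Lemma unitO_eval X : unitO u v (evalE X) <-> normE X = 1.
Proof.
have e1 : evalE 1 = 1 by rewrite -[1 in LHS]/(Eis 1 0) eval_int.
split=> [[_ [y /inO_eval [Y ->]]]|nX].
  by rewrite -evalM -e1 => /eval_inj /unit_norm.
split; first by apply/inO_eval; exists X.
exists (evalE (conjE X)); first by apply/inO_eval; exists (conjE X).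
by rewrite eval_norm nX.
Qed.

Lemma irreducibleO_eval X p : prime p -> normE X = p -> irreducibleO u v (evalE X).
Proof.
move=> pp nX; split.
- by apply/inO_eval; exists X.
- apply/eqP => h; have := eval_norm X; rewrite h mul0r nX => /esym/eqP.
  by rewrite intr_eq0; move: pp; case: (p).
- by move/unitO_eval; rewrite nX => -[] p1; move: pp; rewrite p1.
move=> a b /inO_eval [A ->] /inO_eval [B ->].
rewrite -evalM => /eval_inj e.
have h : (absz (normE A) * absz (normE B) = p)%N by rewrite -abszM -normM -e nX.
have : (absz (normE A) %| p)%N by rewrite -h dvdn_mulr.
case/primeP: (pp) => _ /[apply] /orP [] /eqP nA; [left|right]; apply/unitO_eval.
  by move: (normE_ge0 A) nA; lia.
by move: h (normE_ge0 B); rewrite nA; have := prime_gt0 pp; nia.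
Qed.

(** Clearing the denominators m of a and n of b gives (nX)^3 + (mY)^3 = P^k (mn)^3 with mn
    nonzero. *)
Lemma not_sum_two_cubesK (P : eis) p k : prime p -> normE P = p -> (0 < k < 3)%N ->
  cubic_defect (P ^+ k) -> ~ sum_two_cubesK u v (evalE P ^+ k).
Proof.
move=> pp nP hk dA [a [b [/inK_eval [m [X [m0 hX]]] /inK_eval [n [Y [n0 hY]]] e]]].
have := sum_two_cubes_eq0 P _ k p pp nP hk erefl dA (Eis n 0 * X) (Eis m 0 * Y) (Eis (m * n) 0).
have -> : (Eis n 0 * X) ^+ 3 + (Eis m 0 * Y) ^+ 3 = P ^+ k * Eis (m * n) 0 ^+ 3.
  apply: eval_inj; rewrite evalD [in RHS]evalM !evalX !evalM !eval_int -hX -hY e intrM.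
  by ring.
move=> /(_ erefl) /(congr1 cre) /eqP /=.
by rewrite mulf_eq0 (negPf m0) (negPf n0).
Qed.

End Embedding.

(** * The roots u and v in the complex numbers, and the conclusion *)

Lemma two_rootsE (C : numFieldType) (u v : C) : two_roots u v ->
  u ^+ 2 = - 1 - u /\ v = - 1 - u.
Proof.
move=> [uv h].
have rt z : z = u \/ z = v -> z ^+ 2 + z + 1 = 0.
  by move=> /h; rewrite /root !hornerE => /eqP.
have hu := rt u (or_introl erefl); have hv := rt v (or_intror erefl).
split; first by rewrite -[RHS]addr0 -hu; ring.
apply/eqP; rewrite -subr_eq0; apply/eqP.
have : (u - v) * (v - (- 1 - u)) = 0.
  by transitivity ((u ^+ 2 + u + 1) - (v ^+ 2 + v + 1)); [ring | rewrite hu hv subrr].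
by move/eqP; rewrite mulf_eq0 subr_eq0 (negPf uv) => /eqP.
Qed.

(** The root a + bi is not real, as (a + 1/2)^2 + 3/4 > 0; comparing imaginary parts then gives 2a =
    -1. *)
Lemma conjc_root (R : realType) (u : R[i]) : u ^+ 2 = - 1 - u -> (u^*)%C = - 1 - u.
Proof.
case: u => a b; rewrite expr2 => -[h1 h2].
have b0 : b != 0.
  apply/eqP => b0; move: h1; rewrite b0 => h1.
  by have := sqr_ge0 (a + 2^-1); nra.
have e : 2 * a = -1.
  by apply: (mulfI b0); lra.
by apply/eqP; rewrite eq_complex /=; apply/andP; split; apply/eqP; lra.
Qed.

Theorem theorem2p4 (R : realType) (u v : R[i]) (huv : two_roots u v)
    (p : nat) (hp : prime p) (hp9 : (p = 1 %[mod 9])%N)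
    (hA : ~ exceptionalA u v p)
    (pi : R[i]) (hpi : inO u v pi) (hpi3 : eqmodO u v 3%:R pi 1)
    (hppi : p%:R = pi * (pi^*)%C) :
  ~ sum_two_cubesK u v pi /\ ~ sum_two_cubesK u v (pi ^+ 2).
Proof.
have [hu hv] := two_rootsE _ _ _ huv.
have /(inO_eval _ _ _ hv) [P eP] := hpi.
have e1 (n : nat) : evalE _ u n%:R = n%:R :> R[i].
  by rewrite /evalE !coordE mul0r addr0 natz.
have cP : (pi^*)%C = evalE _ u (conjE P).
  rewrite eP /evalE rmorphD rmorphM !rmorph_int /= conjc_root //.
  by rewrite /conjE /= intrB intrN; ring.
have nP : normE P = p.
  apply/eqP; rewrite -(eqr_int R[i]) -(eval_norm _ _ hu) -cP -eP -hppi.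
  by rewrite -pmulrn.
have dP : cubic_defect P.
  apply: (cubic_defect_norm P p) => //.
    by apply/(dvdO_eval _ _ _ hu hv); rewrite (evalB _ _) (e1 3%N) (e1 1%N) -eP.
  (* If pi were 1 modulo 9, pi itself would be an irreducible factor of p congruent to the integer
     1, making p Exceptional A. *)
  move=> d9; apply: hA; split => //.
    by rewrite -(modn_dvdm p (_ : 3 %| 9)%N) // hp9.
  exists pi; split.
  - by rewrite eP; apply: irreducibleO_eval nP.
  - exists (pi^*)%C => //; apply/(inO_eval _ _ _ hv).
    by exists (conjE P).
  - exists 1; rewrite /eqmodO.
    by move/(dvdO_eval _ _ _ hu hv): d9; rewrite evalB (e1 9%N) (e1 1%N) -eP.
split; rewrite eP.
  by rewrite -[evalE _ _ _]expr1; apply: not_sum_two_cubesK nP _ _.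
by apply: not_sum_two_cubesK nP _ (cubic_defect_sqr _ dP).
Qed.
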